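(* There is an absolute constant $c>0$ such that for all integers $n\geq 1$ and all reals $\epsilon$ with $3^{-n}\leq\epsilon\leq 1/3$, \[\deg_{\epsilon}(\operatorname{ED}_{n}) \geq c\, n^{2/3}\left(\log\frac{1}{\epsilon}\right)^{1/3},\] i.e. $\deg_{\epsilon}(\operatorname{ED}_{n}) =\Omega\left(n^{2/3}(\log(1/\epsilon))^{1/3}\right)$ uniformly in this range.
   Context: Let $\mathcal{D}_{n,r}$ denote the set of Boolean $n\times r$ matrices $x=[x_{i,j}]$ in which every row contains exactly one $1$; view $\mathcal{D}_{n,r}\subseteq\{0,1\}^{nr}\subseteq\mathbb{R}^{nr}$. The element distinctness function $\operatorname{ED}_n\colon\mathcal{D}_{n,n}\to\{0,1\}$ is defined by $\operatorname{ED}_n(x)=1$ if and only if every column of $x$ contains at most one $1$. For a function $f\colon X\to\mathbb{R}$ on a finite set $X\subseteq\mathbb{R}^N$, the $\epsilon$-approximate degree $\deg_\epsilon(f)$ is the least total degree of a real polynomial $p$ on $\mathbb{R}^N$ with $|p(x)-f(x)|\leq\epsilon$ for all $x\in X$ (no constraint is imposed on $p$ outside $X$).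
   Formalization: The range n ≥ 1 is replaced by n ≥ 2: at n = 1 (where ε = 1/3 is the only allowed value) ED_1 is constant, so its approximate degree is 0 while the claimed lower bound is positive. *)

(* Defs.v *)
From HB Require Import structures.
From mathcomp Require Import all_boot all_order all_algebra.
From mathcomp Require Import mpoly.
From mathcomp Require Import boolp classical_sets reals exp.

Set Implicit Arguments.
Unset Strict Implicit.
Unset Printing Implicit Defensive.

Import Order.TTheory GRing.Theory Num.Theory.

Local Open Scope ring_scope.

Section ApproxDegree.
Variables (R : realType) (N : nat) (X : finType).

(* A finite set of points of R^N is a finite type X together with an
   embedding pt : X -> R^N. *)
Variables (pt : X -> 'rV[R]_N) (eps : R) (f : X -> R).

(* msize is one more than the total degree, and 0 for the zero polynomial;
   the zero polynomial is given degree 0. *)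
Definition mdegree (p : {mpoly R[N]}) : nat := (msize p).-1.

Definition approximates (p : {mpoly R[N]}) : Prop :=
  forall x : X, `|p.@[fun k => pt x ord0 k] - f x| <= eps.

Definition approx_degrees : set nat :=
  [set d | exists2 p : {mpoly R[N]}, approximates p & mdegree p = d].

Definition is_least_nat (A : set nat) (d : nat) : Prop :=
  A d /\ forall e, A e -> (d <= e)%N.

(* The default value 0 is never used when pt is injective and 0 <= eps:
   see approx_degreeP below. *)
Definition approx_degree : nat :=
  xget 0%N [set d | is_least_nat approx_degrees d].

Lemma approx_degrees_neq0 :
  injective pt -> 0 <= eps -> exists d, approx_degrees d.
Proof.
move=> pt_inj eps_ge0.
pose q (b : X) : {mpoly R[N]} := \sum_(k < N) ('X_k - (pt b ord0 k)%:MP) ^+ 2.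
have qE (a b : X) : (q b).@[fun k => pt a ord0 k]
    = \sum_(k < N) (pt a ord0 k - pt b ord0 k) ^+ 2.
  rewrite /q rmorph_sum; apply: eq_bigr => k _ /=.
  by rewrite rmorphXn /= mevalB mevalXU mevalC.
have q_eq0 (a b : X) : ((q b).@[fun k => pt a ord0 k] == 0) = (a == b).
  rewrite qE psumr_eq0; last by move=> k _; exact: sqr_ge0.
  apply/allP/eqP => [h|-> k _]; last by rewrite /= subrr expr0n eqxx.
  apply/pt_inj/rowP => k; have /= := h k (mem_index_enum k).
  by rewrite sqrf_eq0 subr_eq0 => /eqP.
pose L (a : X) : {mpoly R[N]} := \prod_(b | b != a) q b.
have LE (a x : X) : (L a).@[fun k => pt x ord0 k] != 0 -> x = a.
  rewrite /L rmorph_prod /=; apply: contra_neq_eq => xa.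
  rewrite (bigD1 x) //=.
  have /eqP -> : (q x).@[fun k => pt x ord0 k] == 0 by rewrite q_eq0.
  by rewrite mul0r.
have Laa (a : X) : (L a).@[fun k => pt a ord0 k] != 0.
  rewrite /L rmorph_prod /=; apply/prodf_neq0 => b ba.
  by rewrite q_eq0 eq_sym.
pose c (a : X) := f a / (L a).@[fun k => pt a ord0 k].
pose p : {mpoly R[N]} := \sum_a c a *: L a.
exists (mdegree p); exists p => // x.
suff -> : p.@[fun k => pt x ord0 k] = f x by rewrite subrr normr0.
rewrite /p rmorph_sum /= (bigD1 x) //= big1 => [|a ax].
  by rewrite addr0 mevalZ /c divfK.
rewrite mevalZ; apply/eqP; rewrite mulf_eq0; apply/orP; right.
by apply: contraNT ax => /LE ->.
Qed.

Lemma approx_degreeP :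
  injective pt -> 0 <= eps -> is_least_nat approx_degrees approx_degree.
Proof.
move=> pt_inj eps_ge0; rewrite /approx_degree; case: xgetP => // nomin.
have [d0 Ad0] := approx_degrees_neq0 pt_inj eps_ge0.
have exA : exists d, `[< approx_degrees d >] by exists d0; apply/asboolP.
case: (ex_minnP exA) => d /asboolP Ad dmin; case: (nomin d).
by split=> // e Ae; apply: dmin; apply/asboolP.
Qed.

End ApproxDegree.

Definition one_per_row (n r : nat) (x : 'M[bool]_(n, r)) : bool :=
  [forall i, #|[set j | x i j]| == 1%N].

Definition Dmx (n r : nat) : finType := {x : 'M[bool]_(n, r) | one_per_row x}.

Definition Dpt (R : realType) (n r : nat) (x : Dmx n r) : 'rV[R]_(n * r) :=
  mxvec (map_mx (fun b : bool => b%:R) (val x)).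

Lemma Dpt_inj (R : realType) (n r : nat) : injective (@Dpt R n r).
Proof.
move=> x y /(can_inj mxvecK) /matrixP exy; apply/val_inj/matrixP => i j.
have /eqP := exy i j; rewrite !mxE.
by case: (val x i j) (val y i j) => [] []; rewrite // ?(eq_sym 0) oner_eq0.
Qed.

Definition ED (n : nat) (x : Dmx n n) : bool :=
  [forall j, #|[set i | val x i j]| <= 1]%N.

Definition approx_degree_ED (R : realType) (n : nat) (eps : R) : nat :=
  approx_degree (@Dpt R n n) eps (fun x => (ED x)%:R).

(* ED_1 is constant, so a lower bound by a positive quantity can hold only
   for n >= 2. *)
Lemma approx_degree_ED1 (R : realType) (eps : R) :
  0 <= eps -> approx_degree_ED 1 eps = 0%N.
Proof.
move=> eps_ge0; apply/eqP; rewrite -leqn0.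
have [_] := approx_degreeP (fun x : Dmx 1 1 => (ED x)%:R) (@Dpt_inj R 1 1) eps_ge0.
apply; exists 1%:MP => [x|]; last by rewrite /mdegree msizeC oner_eq0.
suff -> : ED x by rewrite mevalC subrr normr0.
by apply/forallP => j; rewrite (leq_trans (max_card _)) ?card_ord.
Qed.

(* Main.v *)
Require Import Defs.
From mathcomp Require Import all_boot all_order all_algebra.
From mathcomp Require Import zify ring lra.
From mathcomp Require Import mpoly.
From mathcomp Require Import reals exp.

(* Error reduction.  L disjoint copies of ED_m fit into ED_n as soon as
   L m <= n.  If degree < d cannot approximate ED_m within 1/3, LP duality
   yields psi orthogonal to all monomials of degree < d whose correlation with
   ED_m exceeds |psi|_1 / 3.  A monomial of degree < L d has degree < d in some
   copy, so the L-fold tensor power of psi is orthogonal to it, while it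
   correlates with the conjunction of the copies more than 3^-L times its
   norm.  Hence deg_{3^-L}(ED_n) >= L deg_{1/3}(ED_m).

   Constant error.  Draw a uniform map from n points to m labels and rename the
   labels injectively at random.  The expectation of a degree d polynomial is a
   polynomial of degree <= d in u = 1/m, with u = 0 giving random permutations.
   It is bounded at all u = 1/m, and drops by a constant between u = 0 and
   u = 1/m with m ~ n^2 (birthday paradox).  Lagrange interpolation at
   reciprocals of integers close to Chebyshev extrema shows that such a drop
   forces d^3 >= c n^2. *)

Set Implicit Arguments.
Unset Strict Implicit.
Unset Printing Implicit Defensive.

Import Order.TTheory GRing.Theory Num.Theory.
Local Open Scope ring_scope.

(** * Linear programming duality *)

Section Farkas.
Variable R : realFieldType.

(** Negative coefficients bound [t] from below and positive ones from above. By the second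
    hypothesis no lower bound exceeds an upper bound, so the tightest bound on one side will do. *)
Lemma feasible_one_variable (J : finType) (a b : J -> R) :
    (forall p, a p = 0 -> 0 <= b p) ->
    (forall p q, 0 < a p -> a q < 0 -> 0 <= - a q * b p + a p * b q) ->
  exists t, forall j, a j * t <= b j.
Proof.
move=> h0 h2.
case: (pickP (fun q => a q < 0)) => [q0 q0N | noneg].
  case: (@arg_maxP _ _ J q0 (fun q => a q < 0) (fun q => b q / a q) q0N) => q qN qmax.
  exists (b q / a q) => j; have [ajN | ajP | aj0] := ltgtP (a j) 0.
  - by rewrite mulrC -ler_ndivrMr //; exact: qmax.
  - rewrite mulrA ler_ndivrMr // [b j * _]mulrC.
    by have := h2 j q ajP qN; rewrite mulNr addrC subr_ge0.
  - by rewrite aj0 mul0r h0.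
case: (pickP (fun p => 0 < a p)) => [p0 p0P | nopos].
  case: (@arg_minP _ _ J p0 (fun p => 0 < a p) (fun p => b p / a p) p0P) => p pP pmin.
  exists (b p / a p) => j; have [ajN | ajP | aj0] := ltgtP (a j) 0.
  - by rewrite noneg in ajN.
  - by rewrite mulrC -ler_pdivlMr //; exact: pmin.
  - by rewrite aj0 mul0r h0.
exists 0 => j; rewrite mulr0; apply: h0.
by have := noneg j; have := nopos j; case: ltgtP.
Qed.

(* Fourier-Motzkin elimination: an inequality is kept if its last coefficient
   vanishes, and combined with each of opposite sign otherwise. *)
Lemma farkas (k : nat) (J : finType) (a : J -> nat -> R) (b : J -> R) :
  (exists c : nat -> R, forall j, \sum_(i < k) a j i * c i <= b j) \/
  (exists l : J -> R, [/\ forall j, 0 <= l j,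
      forall i, (i < k)%N -> \sum_j l j * a j i = 0
      & \sum_j l j * b j < 0]).
Proof.
elim: k J a b => [|k IHk] J a b.
  case: (pickP (fun j => b j < 0)) => [j0 bj0 | bge0].
    right; exists (fun j => (j == j0)%:R); split=> //.
    rewrite (bigD1 j0) //= eqxx mul1r big1 ?addr0 // => j /negPf ->.
    by rewrite mul0r.
  by left; exists (fun=> 0) => j; rewrite big_ord0 leNgt bge0.
(* The pair [e] stands for [mu e] times inequality [e.1] plus [nu e] times inequality [e.2]; pairs
   that should contribute nothing become 0 <= 0. *)
pose mu (e : J * J) : R := if a e.1 k == 0 then 1 else
  if (0 < a e.1 k) && (a e.2 k < 0) then - a e.2 k else 0.
pose nu (e : J * J) : R := if a e.1 k == 0 then 0 else
  if (0 < a e.1 k) && (a e.2 k < 0) then a e.1 k else 0.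
have mu_ge0 e : 0 <= mu e.
  rewrite /mu; case: ifP => // _; case: ifP => // /andP[_ h].
  by rewrite oppr_ge0 ltW.
have nu_ge0 e : 0 <= nu e.
  by rewrite /nu; case: ifP => // _; case: ifP => // /andP[h _]; exact: ltW.
have elim_k e : mu e * a e.1 k + nu e * a e.2 k = 0.
  rewrite /mu /nu; case: eqP => [->|_]; first by rewrite mulr0 mul0r addr0.
  by case: ifP => _; rewrite ?mul0r ?addr0 // mulNr [X in _ + X]mulrC addNr.
have [[c hc]|[l [l_ge0 l_orth l_neg]]] := IHk _
    (fun e i => mu e * a e.1 i + nu e * a e.2 i)
    (fun e => mu e * b e.1 + nu e * b e.2).
  left; pose s j := \sum_(i < k) a j i * c i.
  have hs e : 0 <= mu e * (b e.1 - s e.1) + nu e * (b e.2 - s e.2).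
    have := hc e; rewrite -subr_ge0; congr (0 <= _).
    rewrite [X in _ - X](_ : _ = mu e * s e.1 + nu e * s e.2); first by ring.
    rewrite /s !mulr_sumr -big_split /=; apply: eq_bigr => i _; ring.
  have [|p q pP qN|t ht] :=
      @feasible_one_variable J (fun j => a j k) (fun j => b j - s j).
  - move=> p ap0; have := hs (p, p).
    by rewrite /mu /nu /= ap0 eqxx mul1r mul0r addr0.
  - by have := hs (p, q); rewrite /mu /nu /= gt_eqF // pP qN.
  exists (fun i => if (i < k)%N then c i else t) => j.
  rewrite big_ord_recr /= ltnn.
  under eq_bigr do rewrite ltn_ord.
  by rewrite -lerBrDl.
(* Each original inequality collects its multipliers from all pairs that use it. *)
right; exists (fun j => \sum_e l e * (mu e * (e.1 == j)%:R + nu e * (e.2 == j)%:R)).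
have sumE (g : J -> R) :
    \sum_j (\sum_e l e * (mu e * (e.1 == j)%:R + nu e * (e.2 == j)%:R)) * g j
    = \sum_e l e * (mu e * g e.1 + nu e * g e.2).
  have pick1 (p : J) : \sum_j (p == j)%:R * g j = g p.
    rewrite (bigD1 p) //= eqxx mul1r big1 ?addr0 // => j.
    by rewrite eq_sym => /negPf ->; rewrite mul0r.
  under eq_bigr do rewrite mulr_suml.
  rewrite exchange_big; apply: eq_bigr => e _ /=.
  rewrite -(pick1 e.1) -(pick1 e.2) !mulr_sumr -big_split mulr_sumr /=.
  by apply: eq_bigr => j _; ring.
split=> [j|i|]; last by rewrite sumE.
  apply: sumr_ge0 => e _; apply: mulr_ge0 => //.
  by apply: addr_ge0; apply: mulr_ge0 => //; exact: ler0n.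
rewrite ltnS leq_eqVlt sumE => /predU1P[->|/l_orth //].
by apply: big1 => e _; rewrite elim_k mulr0.
Qed.

(** [farkas] is applied to two inequalities per point, one for each sign of the error. *)
Lemma approximation_duality (X I : finType) (A : {pred I}) (g : I -> X -> R)
    (f : X -> R) (delta : R) : 0 <= delta ->
  (exists c : I -> R, forall x, `|\sum_(i in A) c i * g i x - f x| <= delta) \/
  (exists psi : X -> R, (forall i, i \in A -> \sum_x psi x * g i x = 0) /\
    delta * (\sum_x `|psi x|) < \sum_x psi x * f x).
Proof.
move=> delta_ge0.
pose sg (s : bool) : R := if s then 1 else -1.
pose G (x : X) (k : nat) : R :=
  oapp (fun o : 'I_#|A| => g (enum_val o) x) 0 (insub k).
have GE x (o : 'I_#|A|) : G x o = g (enum_val o) x by rewrite /G valK.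
have [[c hc]|[l [l_ge0 l_orth l_neg]]] := farkas #|A|
    (fun e : bool * X => fun k => sg e.1 * G e.2 k)
    (fun e => sg e.1 * f e.2 + delta).
  pose c' i := c (index i (enum A)).
  have c'E x : \sum_(i in A) c' i * g i x = \sum_(o < #|A|) G x o * c o.
    rewrite big_enum_val; apply: eq_bigr => o _; rewrite GE mulrC /c'.
    congr (_ * c _); rewrite (enum_val_nth (enum_val o)).
    by rewrite index_uniq ?enum_uniq // -cardE.
  left; exists c' => x.
  have h s : sg s * \sum_(i in A) c' i * g i x <= sg s * f x + delta.
    rewrite c'E mulr_sumr (le_trans _ (hc (s, x))) //=.
    by rewrite le_eqVlt; apply/orP; left; apply/eqP/eq_bigr => i _; rewrite mulrA.
  have := h true; have := h false; rewrite ler_norml /sg; lra.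
have splitE (F : bool * X -> R) : \sum_e F e = \sum_x (F (true, x) + F (false, x)).
  rewrite (eq_bigr (fun e => F (e.1, e.2))) => [|[] //].
  rewrite -(pair_bigA _ (fun s x => F (s, x))) exchange_big /=.
  by apply: eq_bigr => x _; rewrite big_bool.
(* Since |psi x| is at most the sum of the two multipliers at [x], the negative total [l_neg] gives
   the strict correlation bound. *)
right; exists (fun x => l (false, x) - l (true, x)); split.
  move=> i Ai; have := l_orth (enum_rank_in Ai i) (ltn_ord _).
  rewrite splitE /= => /eqP.
  rewrite -oppr_eq0 => /eqP {2}<-; rewrite -sumrN; apply: eq_bigr => x _.
  by rewrite /sg GE enum_rankK_in //; ring.
move: l_neg; rewrite splitE /sg /= => neg.
have norm_le : \sum_x `|l (false, x) - l (true, x)|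
    <= \sum_x (l (true, x) + l (false, x)).
  apply: ler_sum => x _; have := l_ge0 (true, x); have := l_ge0 (false, x).
  by rewrite ler_norml; lra.
apply: le_lt_trans (ler_wpM2l delta_ge0 norm_le) _.
rewrite -subr_gt0 -oppr_lt0 opprB mulr_sumr -sumrB.
rewrite (le_lt_trans _ neg) // le_eqVlt; apply/orP; left; apply/eqP.
by apply: eq_bigr => x _; ring.
Qed.

End Farkas.

(** * Polynomials bounded at reciprocals of integers *)

Lemma lagrange_interpolation (F : fieldType) (d : nat) (x : 'I_d -> F)
    (P : {poly F}) (y : F) :
    injective x -> (size P <= d)%N ->
  P.[y] = \sum_i P.[x i] * \prod_(j < d | j != i) ((y - x j) / (x i - x j)).
Proof.
move=> x_inj szP.
pose ell (i : 'I_d) : {poly F} :=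
  \prod_(j < d | j != i) ((x i - x j)^-1 *: ('X - (x j)%:P)).
have ellE i z : (ell i).[z] = \prod_(j < d | j != i) ((z - x j) / (x i - x j)).
  rewrite horner_prod; apply: eq_bigr => j _.
  by rewrite hornerZ hornerXsubC mulrC.
pose Q := \sum_i P.[x i] *: ell i.
have QE z : Q.[z] = \sum_i P.[x i] * \prod_(j < d | j != i) ((z - x j) / (x i - x j)).
  by rewrite horner_sum; apply: eq_bigr => i _; rewrite hornerZ ellE.
have szQ : (size Q <= d)%N.
  apply: (leq_trans (size_sum _ _ _)); apply/bigmax_leqP => i _.
  apply: (leq_trans (size_scale_leq _ _)); apply: (leq_trans (size_prod_leq _ _)).
  have : (\sum_(j < d | j != i) size ((x i - x j)^-1 *: ('X - (x j)%:P))
      <= \sum_(j < d | j != i) 2)%N.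
    apply: leq_sum => j _.
    by apply: (leq_trans (size_scale_leq _ _)); rewrite size_XsubC.
  have cE : #|(fun j : 'I_d => j != i)| = d.-1 by rewrite (cardC1 i) card_ord.
  rewrite sum_nat_const cE; move: (\sum_(j < d | _) _)%N (ltn_ord i) => S; lia.
rewrite -QE; congr (_.[_]).
apply/eqP; rewrite -subr_eq0; apply/eqP.
apply: (@roots_geq_poly_eq0 _ _ (codom x)).
- apply/allP => _ /codomP[i ->]; rewrite rootE hornerD hornerN QE.
  rewrite (bigD1 i) //= [X in _ * X]big1 => [|j ji]; last first.
    by rewrite divff // subr_eq0 (inj_eq x_inj) eq_sym.
  rewrite mulr1 big1 ?addr0 ?subrr // => k ki.
  by rewrite (bigD1 i) 1?eq_sym //= subrr !mul0r mulr0.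
- by rewrite map_inj_uniq ?enum_uniq.
rewrite size_codom card_ord (leq_trans (size_polyD _ _)) //.
by rewrite size_polyN geq_max szP szQ.
Qed.

Lemma prod_rising (a r : nat) : (\prod_(j < r) (a.+1 + j) * a`! = (a + r)`!)%N.
Proof.
elim: r => [|r IHr]; first by rewrite big_ord0 mul1n addn0.
by rewrite big_ord_recr /= mulnAC IHr addnS factS mulnC addSn.
Qed.

(** After division by r! (r + q)!, two products of [q] consecutive integers remain, starting at r +
    1 and at r + q + 1. *)
Lemma fact_sq_le (q r : nat) : ((r + q)`! * (r + q)`! <= r`! * (r + q + q)`!)%N.
Proof.
rewrite -{1}(prod_rising r q) -(prod_rising (r + q) q).
rewrite -mulnA mulnCA leq_mul2l leq_mul2r; apply/orP; right.
apply/orP; right; apply: leq_prod => j _; lia.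
Qed.

Lemma prod_dist (R : numDomainType) (i r : nat) :
  \prod_(0 <= j < i + r.+1 | j != i) `|j%:R - i%:R| = (i`! * r`!)%:R :> R.
Proof.
rewrite (@big_cat_nat _ _ _ i) ?leq_addr //= natrM; congr (_ * _).
  rewrite big_nat_cond (eq_bigl (fun j => (j < i)%N)); last first.
    by move=> j /=; case: ltngtP.
  rewrite -ffactnn ffact_prod natr_prod big_mkord.
  apply: eq_big => [j|j _]; first by rewrite ltn_ord.
  by rewrite distrC -natrB ?normr_nat // ltnW.
rewrite big_ltn_cond ?eqxx; last by rewrite -addSnnS leq_addr.
rewrite /= -{1}[i.+1]add0n big_addn (_ : i + r.+1 - i.+1 = r)%N; last by lia.
rewrite fact_prod natr_prod big_add1 /= big_mkord [RHS]big_mkord.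
apply: eq_big => [j|j _]; first by rewrite neq_ltn addnS ltnS leq_addl orbT.
by rewrite -natrB ?normr_nat ?addnS ?subSn ?addnK ?leq_addl // leqW ?leq_addl.
Qed.

(** These are the absolute Lagrange weights at 0 for the nodes 1, 4, ..., d^2. With q = i + 1 the
    product is 2 (d!)^2 / ((d - q)! (d + q)!). *)
Lemma chebyshev_weight (R : realFieldType) (d : nat) (i : 'I_d) :
  \prod_(j < d | j != i)
    (j.+1%:R ^+ 2 / `|j.+1%:R ^+ 2 - i.+1%:R ^+ 2|) <= 2 :> R.
Proof.
set q := i.+1; have dE : d = (i + (d - q).+1)%N by have := ltn_ord i; lia.
set r := (d - q)%N in dE.
have q_neq0 : q%:R != 0 :> R by rewrite pnatr_eq0.
have fact_neq0 k : k`!%:R != 0 :> R by rewrite pnatr_eq0 -lt0n fact_gt0.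
have prod1 : \prod_(j < d | j != i) j.+1%:R = d`!%:R / q%:R :> R.
  have <- : \prod_(j < d) j.+1%:R = d`!%:R :> R.
    by rewrite fact_prod natr_prod big_add1 /= big_mkord.
  by rewrite [in RHS](bigD1 i) //= [RHS]mulrC mulKf.
have prod2 : \prod_(j < d | j != i) `|j%:R - i%:R| = (i`! * r`!)%:R :> R.
  by rewrite -prod_dist -dE big_mkord.
have prod3 : \prod_(j < d | j != i) (j.+1 + q)%:R
    = (d + q)`!%:R / (q + q)%:R / q`!%:R :> R.
  have qq_neq0 : (q + q)%:R != 0 :> R by rewrite pnatr_eq0.
  have -> : (d + q)`!%:R = (\prod_(j < d) (j.+1 + q)%:R) * q`!%:R :> R.
    rewrite addnC -prod_rising natrM natr_prod; congr (_ * _).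
    by apply: eq_bigr => j _; congr (_%:R); lia.
  by rewrite mulrAC mulfK // [in RHS](bigD1 i) //= [RHS]mulrC mulKf.
(* Each denominator splits as |j - i| (j + 1 + q). The factor 2q omitted at j = i is the source of
   the constant 2. *)
have -> : \prod_(j < d | j != i) (j.+1%:R ^+ 2 / `|j.+1%:R ^+ 2 - q%:R ^+ 2|)
    = 2 * (d`! * d`!)%:R / (r`! * (d + q)`!)%:R :> R.
  rewrite prodf_div prodrXl prod1.
  rewrite [X in _ / X = _](_ : _ = (\prod_(j < d | j != i) `|j%:R - i%:R|)
      * \prod_(j < d | j != i) (j.+1 + q)%:R); last first.
    rewrite -big_split; apply: eq_bigr => j _ /=.
    rewrite subr_sqr normrM -natrD normr_nat /q -[j.+1]addn1 -[i.+1]addn1.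
    by rewrite !natrD opprD addrACA subrr addr0.
  rewrite prod2 prod3 factS -/q !natrM natrD.
  move: (q%:R : R) (i`!%:R : R) (r`!%:R : R) ((d + q)`!%:R : R) q_neq0
    (fact_neq0 i) (fact_neq0 r) (fact_neq0 (d + q)%N) => u v w z u0 v0 w0 z0.
  by field; rewrite u0 v0 w0 z0 -mulr2n mulrn_eq0.
rewrite ler_pdivrMr ?ler_pM2l ?ler_nat ?ltr0n ?muln_gt0 ?fact_gt0 //.
have := fact_sq_le q r; suff -> : (r + q)%N = d by [].
by rewrite dE /q; lia.
Qed.

(* Integers close to 2 d^3 / i^2, so that the [1 / node d i] are close to
   Chebyshev extrema.  The rounding makes [i ^ 2 * node d i] decrease in [i],
   which is why the Lagrange weights are no larger than the exact ones. *)
Definition node (d i : nat) : nat := (((2 * d - i) * d ^ 2) %/ i ^ 2).+1.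

(** Rounding leaves i^2 * [node d i] above (2d - i) d^2 and at most (2d - i + 1) d^2; these ranges
    are disjoint for distinct indices. *)
Lemma node_sq_mono (d i j : nat) : (0 < i)%N -> (i < j)%N -> (j <= d)%N ->
  (j ^ 2 * node d j < i ^ 2 * node d i)%N.
Proof.
move=> i0 ij jd; have i20 : (0 < i ^ 2)%N by rewrite expn_gt0 i0.
rewrite /node [X in (_ < X)%N]mulnC; apply: leq_ltn_trans (ltn_ceil _ i20).
rewrite mulnC mulSn.
apply: leq_trans (leq_add (leqnn _) (leq_divM _ _)) _.
have jd2 : (j ^ 2 <= d ^ 2)%N by rewrite leq_exp2r.
apply: leq_trans (leq_add jd2 (leqnn _)) _.
by rewrite -mulSn leq_mul2r; apply/orP; right; lia.
Qed.

Lemma node_sq_le (d i : nat) : (0 < i)%N -> (i <= d)%N ->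
  (i ^ 2 * node d i <= 2 * d ^ 3)%N.
Proof.
move=> i0 id; rewrite /node mulnC mulSn.
have h1 := leq_divM ((2 * d - i) * d ^ 2) (i ^ 2).
apply: leq_trans (leq_add (leqnn _) h1) _.
have -> : (2 * d ^ 3 = i * d ^ 2 + (2 * d - i) * d ^ 2)%N.
  by rewrite -mulnDl subnKC ?expnS ?mulnA //; lia.
rewrite leq_add2r -mulnn leq_mul2l (leq_trans id) ?orbT //.
by rewrite -mulnn leq_pmulr //; lia.
Qed.

(** The comparison with [chebyshev_weight] is factor by factor. Each factor is at most t / |t - 1|
    with t = m i / m j, and by the last hypothesis t lies farther from 1, on the same side, than (j
    + 1)^2 / (i + 1)^2. *)
Lemma lagrange_weight_le (R : realFieldType) (d : nat) (m : nat -> R) (y : R)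
    (i : 'I_d) :
    (forall j, 0 < m j) -> (forall j : 'I_d, 0 <= y <= (m j)^-1) ->
    (forall j k, (j < k)%N -> (k < d)%N ->
       k.+1%:R ^+ 2 * m k < j.+1%:R ^+ 2 * m j) ->
  `|\prod_(j < d | j != i) ((y - (m j)^-1) / ((m i)^-1 - (m j)^-1))| <= 2.
Proof.
move=> m0 hy hm; apply: le_trans (chebyshev_weight R i).
rewrite normr_prod; apply: ler_prod => j ji; rewrite normr_ge0 /=.
have m_neq0 k : m k != 0 by rewrite gt_eqF.
have mono2 (a b : nat) : (a < b)%N -> a.+1%:R ^+ 2 < b.+1%:R ^+ 2 :> R.
  by move=> ab; rewrite ltr_pXn2r // ?nnegrE ?ler0n // ltr_nat.
have key : `|(y - (m j)^-1) / ((m i)^-1 - (m j)^-1)| <= m i / `|m i - m j|.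
  (* If the values coincide, both sides are 0 because the inverse of 0 is 0. *)
  have [-> | mij] := eqVneq (m i) (m j).
    by rewrite subrr invr0 mulr0 normr0 subrr normr0 invr0 mulr0.
  have -> : (m i)^-1 - (m j)^-1 = (m j - m i) / (m i * m j).
    by field; rewrite m_neq0 m_neq0.
  rewrite normrM normfV normrM normfV [`|m j - m i|]distrC invfM invrK.
  rewrite [`|m i * m j|]gtr0_norm ?mulr_gt0 //.
  have -> : m i / `|m i - m j| = (m j)^-1 * (`|m i - m j|^-1 * (m i * m j)).
    by move: (_^-1) (m_neq0 j) => E mj0; field.
  apply: ler_wpM2r.
    by rewrite mulr_ge0 ?invr_ge0 ?normr_ge0 // ltW ?mulr_gt0.
  have /andP[y0 yj] := hy j.
  by rewrite distrC ger0_norm ?subr_ge0 // lerBlDr lerDl.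
apply: le_trans key _.
have [ij | ij | /val_inj eij] := ltngtP i j; last by rewrite eij eqxx in ji.
- have hij := hm _ _ ij (ltn_ord j); have h2 := mono2 _ _ ij.
  have mm : m j < m i.
    rewrite -(ltr_pM2l (_ : 0 < j.+1%:R ^+ 2 :> R)) ?exprn_gt0 ?ltr0n //.
    by apply: (lt_trans hij); rewrite ltr_pM2r.
  rewrite gtr0_norm ?subr_gt0 // gtr0_norm ?subr_gt0 //.
  rewrite ler_pdivrMr ?subr_gt0 // mulrAC ler_pdivlMr ?subr_gt0 //.
  move: (_ ^+ 2) (_ ^+ 2) hij => u v; nra.
- have hij := hm _ _ ij (ltn_ord i); have h2 := mono2 _ _ ij.
  have mm : m i < m j.
    rewrite -(ltr_pM2l (_ : 0 < i.+1%:R ^+ 2 :> R)) ?exprn_gt0 ?ltr0n //.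
    by apply: (lt_trans hij); rewrite ltr_pM2r.
  rewrite ltr0_norm ?subr_lt0 // ltr0_norm ?subr_lt0 // !opprB.
  rewrite ler_pdivrMr ?subr_gt0 // mulrAC ler_pdivlMr ?subr_gt0 //.
  move: (_ ^+ 2) (_ ^+ 2) hij => u v; nra.
Qed.

Lemma sum_inv_sq_le2 (R : realFieldType) (d : nat) :
  \sum_(i < d) (i.+1%:R ^+ 2)^-1 <= 2 :> R.
Proof.
suff h k : \sum_(i < k.+1) (i.+1%:R ^+ 2)^-1 <= 2 - k.+1%:R^-1 :> R.
  case: d => [|d]; first by rewrite big_ord0.
  by apply: le_trans (h d) _; rewrite gerBl invr_ge0.
elim: k => [|k IHk]; first by rewrite big_ord1 expr1n invr1; lra.
rewrite big_ord_recr /=; apply: le_trans (lerD IHk (lexx _)) _.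
rewrite -[k.+2]addn1 natrD; have a0 : 0 < k.+1%:R :> R by rewrite ltr0n.
move: (k.+1%:R) a0 => a a0.
rewrite -subr_ge0 [X in 0 <= X](_ : _ = (a * (a + 1) ^+ 2)^-1).
  by rewrite invr_ge0 mulr_ge0 ?exprn_ge0 // ltW // ltr_wpDr.
by field; apply/andP; split; lra.
Qed.

(** Write P - P(0) = X Q. At the reciprocal of a node [m i], |Q| is at most B [m i], hence at most 2
    B d^3 / (i + 1)^2. Interpolating Q at 1/m0, which lies left of all these points, costs a factor
    2 for the weights and 2 for the sum of inverse squares. *)
Lemma reciprocal_bound (R : realFieldType) (P : {poly R}) (d m0 : nat) (B : R) :
    (0 < d)%N -> (size P <= d.+1)%N ->
    (forall m, (0 < m)%N -> `|P.[m%:R^-1] - P.[0]| <= B) ->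
    (2 * d ^ 3 <= m0)%N ->
  `|P.[m0%:R^-1] - P.[0]| <= 8 * B * d%:R ^+ 3 / m0%:R.
Proof.
move=> d0 szP hB dm.
have [Q PQ] : exists Q, P - P.[0]%:P = Q * 'X.
  have : root (P - P.[0]%:P) 0 by rewrite rootE hornerD hornerN hornerC subrr.
  by move=> /factor_theorem[Q ->]; exists Q; rewrite subr0.
have szQ : (size Q <= d)%N.
  have [->|Q0] := eqVneq Q 0; first by rewrite size_poly0.
  rewrite -ltnS -size_mulX // -PQ (leq_trans (size_polyD _ _)) //.
  by rewrite size_polyN geq_max szP (leq_trans (size_polyC_leq1 _)).
have QE y : P.[y] - P.[0] = y * Q.[y].
  have := congr1 (fun p => p.[y]) PQ.
  by rewrite hornerD hornerN hornerC hornerMX mulrC.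
pose m i : R := (node d i.+1)%:R.
have m_gt0 i : 0 < m i by rewrite ltr0n.
have m_mono j k : (j < k)%N -> (k < d)%N ->
    k.+1%:R ^+ 2 * m k < j.+1%:R ^+ 2 * m j.
  by move=> jk kd; rewrite -!natrX -!natrM ltr_nat node_sq_mono.
have m_le i : (i < d)%N -> m i <= 2 * d%:R ^+ 3 * (i.+1%:R ^+ 2)^-1.
  move=> id; rewrite ler_pdivlMr ?exprn_gt0 ?ltr0n // mulrC.
  by rewrite -!natrX -!natrM ler_nat node_sq_le.
have m0_gt0 : (0 < m0)%N by apply: leq_trans dm; rewrite muln_gt0 expn_gt0 d0.
have hy (j : 'I_d) : (0 : R) <= m0%:R^-1 <= (m j)^-1.
  rewrite invr_ge0 ler0n /= lef_pV2 ?posrE ?ltr0n // ler_nat.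
  apply: leq_trans dm; apply: leq_trans (node_sq_le (ltn0Sn j) (ltn_ord j)).
  by rewrite leq_pmull // expn_gt0.
have x_inj : injective (fun i : 'I_d => (m i)^-1).
  move=> i j /invr_inj mij; apply/val_inj.
  have [ij | ij | //] := ltngtP i j.
  - have := m_mono _ _ ij (ltn_ord j).
    by rewrite mij ltr_pM2r // ltr_pXn2r ?nnegrE // ltr_nat ltnS ltnNge ltnW.
  - have := m_mono _ _ ij (ltn_ord i).
    by rewrite mij ltr_pM2r // ltr_pXn2r ?nnegrE // ltr_nat ltnS ltnNge ltnW.
have B0 : 0 <= B by apply: le_trans (hB 1%N _).
have hQ (i : 'I_d) : `|Q.[(m i)^-1]| <= B * m i.
  have := hB (node d i.+1) isT; rewrite QE normrM gtr0_norm ?invr_gt0 //.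
  by rewrite mulrC ler_pdivrMr.
rewrite QE normrM ger0_norm ?invr_ge0 // mulrC ler_wpM2r ?invr_ge0 //.
rewrite (lagrange_interpolation _ x_inj szQ).
apply: le_trans (ler_norm_sum _ _ _) _.
have : \sum_(i < d) (2 * B * (2 * d%:R ^+ 3)) * (i.+1%:R ^+ 2)^-1
    <= 8 * B * d%:R ^+ 3.
  rewrite -mulr_sumr; apply: le_trans (ler_wpM2l _ (sum_inv_sq_le2 R d)) _.
    by rewrite !mulr_ge0 ?exprn_ge0.
  by rewrite le_eqVlt; apply/orP; left; apply/eqP; ring.
apply: le_trans; apply: ler_sum => i _.
have hW := @lagrange_weight_le R d m _ i m_gt0 hy m_mono.
rewrite normrM; apply: le_trans (ler_pM _ _ (hQ i) hW) _ => //.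
have B20 : 0 <= 2 * B by rewrite mulr_ge0.
rewrite [X in X <= _](_ : _ = 2 * B * m i); last by ring.
by apply: le_trans (ler_wpM2l B20 (m_le i (ltn_ord i))) _; rewrite !mulrA.
Qed.

(** * Random maps with few values *)

(* A map [y] stands for the matrix with ones at the [(i, y i)], and [S] for the
   monomial with variables x_e, e in S: its value at [y] is [extends S y]. *)
Definition extends (n : nat) (S : {set 'I_n * 'I_n}) (y : {ffun 'I_n -> 'I_n}) :=
  [forall e in S, y e.1 == e.2].

Section RandomMap.
Variables (R : realFieldType) (n : nat).

(* [(map_weight n t).[1 / m]] is the probability of each [y] with [t] values
   when a uniform map from [n] points to [m] labels is drawn and its labels
   are then renamed by a random injection into [n] names; [k < n] gives the
   marginals on [k] points. *)
Definition map_weight (k t : nat) : {poly R} :=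
  (n ^_ t)%:R^-1 *: ('X^(k - t) * \prod_(i < t) (1 - i%:R *: 'X)).

Lemma size_map_weight (k t : nat) : (t <= k)%N ->
  (size (map_weight k t) <= k.+1)%N.
Proof.
move=> tk; apply: leq_trans (size_scale_leq _ _) _.
pose f i : {poly R} := 1 - i%:R *: 'X.
have hp : (size (\prod_(i < t) f i)%R <= t.+1)%N.
  apply: leq_trans (size_prod_leq _ _) _.
  have : (\sum_(i < t) size (f i) <= \sum_(i < t) 2)%N.
    apply: leq_sum => i _; apply: leq_trans (size_polyD _ _) _.
    rewrite size_polyN geq_max size_poly1 /=.
    by apply: leq_trans (size_scale_leq _ _) _; rewrite size_polyX.
  rewrite sum_nat_const !card_ord; move: (\sum_(i < t) _)%N => s; lia.
apply: leq_trans (size_polyMleq _ _) _; rewrite size_polyXn.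
move: (size _) hp => s; lia.
Qed.

(** A further point takes one of the [t] values already used or one of the n - t others.
    Algebraically this is tX + (1 - tX) = 1. *)
Lemma map_weight_rec (k t : nat) : (t <= k)%N -> (k < n)%N ->
  map_weight k t = map_weight k.+1 t *+ t + map_weight k.+1 t.+1 *+ (n - t).
Proof.
move=> tk kn; rewrite /map_weight.
have nt0 : (n - t)%:R != 0 :> R by rewrite pnatr_eq0; lia.
have -> : (n ^_ t.+1)%:R^-1 = (n ^_ t)%:R^-1 / (n - t)%:R :> R.
  by rewrite ffactnSr natrM invfM.
rewrite subSS subSn // exprS big_ord_recr /=.
move: ('X^(k - t)) (\prod_(i < t) _) (n ^_ t)%:R^-1 => u v a.
rewrite -!scaler_nat !scalerA [(n - t)%:R * _]mulrC divfK // [t%:R * _]mulrC.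
rewrite -scalerA -scalerDr; congr (_ *: _).
rewrite -!mul_polyC; ring.
Qed.

(** This computes the marginal on [T]: the values at the points outside [T] are summed out one at a
    time. *)
Lemma sum_map_weight_extensions (T : {set 'I_n}) (a : {ffun 'I_n -> 'I_n}) :
  \sum_(y : {ffun 'I_n -> 'I_n} | [forall i in T, y i == a i])
    map_weight n #|[set y i | i : 'I_n]| = map_weight #|T| #|a @: T|.
Proof.
have [k] := ubnP (n - #|T|)%N.
elim: k => // k IHk in T a *; rewrite ltnS => Tk.
have [/setP fullT | ] := eqVneq T setT.
  rewrite (big_pred1 a) => [|y]; last first.
    apply/forall_inP/eqP => [h|-> //]; apply/ffunP => i.
    by apply/eqP/h; rewrite fullT inE.
  have -> : T = setT by apply/setP.
  rewrite cardsT card_ord; congr map_weight; apply: eq_card => z.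
  by apply/imsetP/imsetP => -[i _ ->]; exists i; rewrite ?inE.
rewrite -subTset => /subsetPn[i0 _ i0T].
have cT : (#|T| < n)%N.
  rewrite -[X in (_ < X)%N](card_ord n) -cardsT proper_card // properT.
  by apply: contraNneq i0T => ->; rewrite inE.
pose upd (j : 'I_n) := [ffun i => if i == i0 then j else a i].
rewrite (partition_big (fun y : {ffun 'I_n -> 'I_n} => y i0) predT) //=.
have step j : \sum_(y : {ffun 'I_n -> 'I_n} |
      [forall i in T, y i == a i] && (y i0 == j))
    map_weight n #|[set y i | i : 'I_n]|
    = map_weight #|T|.+1 #|j |: a @: T|.
  have <- : #|i0 |: T| = #|T|.+1 by rewrite cardsU1 i0T.
  have imE : upd j @: (i0 |: T) = j |: a @: T.
    rewrite imsetU1 ffunE eqxx; congr (_ |: _).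
    apply: eq_in_imset => i iT; rewrite ffunE; case: eqP => // ii.
    by rewrite ii (negPf i0T) in iT.
  rewrite -imE -IHk; last by rewrite cardsU1 i0T; lia.
  apply: eq_bigl => y; apply/andP/forall_inP => [[/forall_inP h /eqP yj] i|h].
    rewrite in_setU1 ffunE; case: eqP => [-> _ | _ /= iT]; first by rewrite yj.
    exact: h.
  split; last by have := h i0; rewrite setU11 ffunE eqxx; apply.
  apply/forall_inP => i iT; have := h i; rewrite in_setU1 iT orbT ffunE.
  have -> : (i == i0) = false by apply: contraNF i0T => /eqP <-.
  exact.
(* Split by whether the value at [i0] is already used, as in [map_weight_rec]. *)
rewrite (eq_bigr _ (fun j _ => step j)) (bigID (mem (a @: T))) /=.
rewrite (map_weight_rec (leq_imset_card _ _) cT); congr (_ + _).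
  rewrite (eq_bigr (fun=> map_weight #|T|.+1 #|a @: T|)) => [|j jT].
    by rewrite sumr_const.
  by rewrite cardsU1 jT.
rewrite (eq_bigr (fun=> map_weight #|T|.+1 #|a @: T|.+1)) => [|j jT].
  rewrite sumr_const; congr (_ *+ _).
  by rewrite -[X in (X - _)%N](card_ord n) -(cardC (mem (a @: T))) addKn.
by rewrite cardsU1 jT.
Qed.

(** Its value at 1/m is the expectation of [F] under the random map, and its value at 0 the average
    of [F] over permutations. *)
Definition map_sum (F : {ffun 'I_n -> 'I_n} -> R) : {poly R} :=
  \sum_y F y *: map_weight n #|[set y i | i : 'I_n]|.

(** Either [S] is contradictory and the sum is 0, or [S] prescribes the map on at most #|S| points
    and the sum is a marginal weight. *)
Lemma size_map_sum_extends (S : {set 'I_n * 'I_n}) :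
  (size (map_sum (fun y => (extends S y)%:R)) <= #|S|.+1)%N.
Proof.
have -> : map_sum (fun y => (extends S y)%:R)
    = \sum_(y : {ffun 'I_n -> 'I_n} | extends S y)
        map_weight n #|[set y i | i : 'I_n]|.
  rewrite [RHS]big_mkcond; apply: eq_bigr => y _.
  by case: ifP; rewrite ?scale1r ?scale0r.
case: (pickP (extends S)) => [a /forall_inP aS | S0]; last first.
  by rewrite big_pred0 // size_poly0.
pose T := [set e.1 | e in S].
rewrite (eq_bigl (fun y : {ffun 'I_n -> 'I_n} => [forall i in T, y i == a i])) => [|y].
  rewrite sum_map_weight_extensions.
  apply: leq_trans (size_map_weight (leq_imset_card _ _)) _.
  by rewrite ltnS leq_imset_card.
apply/forall_inP/forall_inP => [h i /imsetP[e eS ->] | h e eS].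
  by rewrite (eqP (h e eS)) eq_sym; exact: aS.
by rewrite (eqP (h _ (imset_f _ eS))); exact: aS.
Qed.

(** At u = 1/m the factors are nonnegative when t <= m; otherwise the factor i = m vanishes. *)
Lemma map_weight_ge0 (t : nat) (u : R) :
    (t <= n)%N -> (u = 0 \/ exists2 m, (0 < m)%N & u = m%:R^-1) ->
  0 <= (map_weight n t).[u].
Proof.
move=> tn hu.
have u0 : 0 <= u by case: hu => [->|[m _ ->]]; rewrite ?invr_ge0.
rewrite hornerZ hornerM hornerXn horner_prod.
rewrite mulr_ge0 ?invr_ge0 ?ler0n // mulr_ge0 ?exprn_ge0 //.
have E (i : nat) : (1 - i%:R *: 'X : {poly R}).[u] = 1 - i%:R * u.
  by rewrite hornerD hornerN hornerZ hornerX hornerC.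
case: hu => [u0E|[m m0 uE]].
  by apply: prodr_ge0 => i _; rewrite E u0E mulr0 subr0.
have mP : 0 < m%:R :> R by rewrite ltr0n.
have [tm|mt] := leqP t m.
  apply: prodr_ge0 => i _; rewrite E uE subr_ge0 ler_pdivrMr // mul1r ler_nat.
  by rewrite ltnW // (leq_trans (ltn_ord i)).
by rewrite (bigD1 (Ordinal mt)) //= E uE divff ?subrr ?mul0r // gt_eqF.
Qed.

Lemma map_sum_const (a : R) : map_sum (fun=> a) = a%:P.
Proof.
rewrite /map_sum -scaler_sumr -mul_polyC -[RHS]mulr1; congr (_ * _).
have := sum_map_weight_extensions set0 [ffun i => i].
rewrite imset0 cards0 [RHS]/map_weight ffactn0 subnn expr0 big_ord0 invr1.
rewrite scale1r mul1r; apply: etrans.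
rewrite [RHS]big_mkcond; apply: eq_bigr => y _.
by case: forall_inP => // h; case: h => i; rewrite inE.
Qed.

Lemma map_sum_injective :
  map_sum (fun y => (injectiveb y)%:R) = \prod_(i < n) (1 - i%:R *: 'X).
Proof.
rewrite /map_sum (eq_bigr (fun y : {ffun 'I_n -> 'I_n} =>
    if injectiveb y then map_weight n n else 0)) => [|y _]; last first.
  case: ifP => [/injectiveP y_inj|]; last by rewrite scale0r.
  by rewrite scale1r card_imset // card_ord.
rewrite -big_mkcond sumr_const -[X in _ *+ X]/(#|_|).
rewrite -cardsE card_inj_ffuns card_ord /map_weight subnn expr0 mul1r.
by rewrite -scaler_nat scalerA divff ?scale1r // pnatr_eq0 ffactnn -lt0n fact_gt0.
Qed.

Lemma map_sum_le (F G : {ffun 'I_n -> 'I_n} -> R) (delta u : R) :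
    (u = 0 \/ exists2 m, (0 < m)%N & u = m%:R^-1) ->
    (forall y, `|F y - G y| <= delta) ->
  `|(map_sum F).[u] - (map_sum G).[u]| <= delta.
Proof.
move=> hu hFG; rewrite -hornerN -hornerD -sumrB horner_sum.
apply: le_trans (ler_norm_sum _ _ _) _.
rewrite -[delta](hornerC _ u) -map_sum_const.
rewrite horner_sum; apply: ler_sum => y _.
have w0 : 0 <= (map_weight n #|[set y i | i : 'I_n]|).[u].
  by apply: map_weight_ge0 => //; rewrite (leq_trans (leq_imset_card _ _)) ?card_ord.
move: (map_weight _ _) w0 => W w0.
by rewrite -scalerBl !hornerZ normrM (ger0_norm w0) ler_wpM2r.
Qed.

(** An algebraic substitute for bounding the birthday product by an exponential. The induction step
    is (1 - Nu)(1 + su + Nu) <= 1 + su. *)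
Lemma prod_subr_le (u : R) (N : nat) :
    0 <= u -> (forall i, (i < N)%N -> i%:R * u <= 1) ->
  \prod_(i < N) (1 - i%:R * u) * (1 + (N * N.-1)%:R / 2 * u) <= 1.
Proof.
move=> u0; elim: N => [|N IHN] h.
  by rewrite big_ord0 mul0n mulr0n !mul0r addr0 mulr1.
have := IHN (fun i iN => h i (ltnW iN)).
have p0 : 0 <= \prod_(i < N) (1 - i%:R * u).
  by apply: prodr_ge0 => i _; rewrite subr_ge0 h // ltnS ltnW.
rewrite big_ord_recr /= => IH; apply: le_trans IH => {IHN}.
rewrite -mulrA ler_wpM2l //.
have -> : (N.+1 * N)%:R / 2 = (N * N.-1)%:R / 2 + N%:R :> R.
  case: N {h p0} => [|N]; first by rewrite !mul0r add0r.
  by rewrite /= -[N.+2]addn2 -[N.+1]addn1 !natrM !natrD; field.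
have s0 : 0 <= (N * N.-1)%:R / 2 :> R by rewrite divr_ge0.
move: (_ / 2) s0 (ler0n R N) => s s0 N0.
have x0 := mulr_ge0 s0 u0; have y0 := mulr_ge0 N0 u0.
have := mulr_ge0 x0 y0; have := mulr_ge0 y0 y0; nra.
Qed.

End RandomMap.

(** Averaging turns the approximant and injectivity into univariate [P] and [Q], within 1/3 of each
    other at 0 and at all 1/m. [Q] drops from 1 to at most 1/4, which forces a drop of [P]. *)
Lemma degree_lower_bound (R : realFieldType) (n d : nat)
    (c : {set 'I_n * 'I_n} -> R) : (2 <= n)%N ->
    (forall y : {ffun 'I_n -> 'I_n},
       `|\sum_(S : {set 'I_n * 'I_n} | (#|S| <= d)%N) c S * (extends S y)%:R
         - (injectiveb y)%:R|
       <= 3^-1) ->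
  (0 < d)%N /\ (n ^ 2 <= 2500 * d ^ 3)%N.
Proof.
move=> n2 happ.
pose h (y : {ffun 'I_n -> 'I_n}) :=
  \sum_(S : {set 'I_n * 'I_n} | (#|S| <= d)%N) c S * (extends S y)%:R.
pose P := map_sum h.
pose Q := map_sum (fun y : {ffun 'I_n -> 'I_n} => (injectiveb y)%:R : R).
have szP : (size P <= d.+1)%N.
  rewrite /P (_ : map_sum h = \sum_(S : {set 'I_n * 'I_n} | (#|S| <= d)%N)
      c S *: map_sum (fun y => (extends S y)%:R)).
    apply: leq_trans (size_sum _ _ _) _; apply/bigmax_leqP => S Sd.
    apply: leq_trans (size_scale_leq _ _) _.
    by apply: leq_trans (size_map_sum_extends _ _) _; rewrite ltnS.
  rewrite /map_sum; under [RHS]eq_bigr do rewrite scaler_sumr.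
  rewrite exchange_big; apply: eq_bigr => y _ /=.
  by rewrite scaler_suml; apply: eq_bigr => S _; rewrite scalerA.
have PQ u : (u = 0 \/ exists2 m, (0 < m)%N & u = m%:R^-1) ->
  `|P.[u] - Q.[u]| <= 3^-1 by move=> hu; apply: map_sum_le.
have QE u : Q.[u] = \prod_(i < n) (1 - i%:R * u).
  rewrite /Q map_sum_injective horner_prod; apply: eq_bigr => i _.
  by rewrite hornerD hornerN hornerZ hornerX hornerC.
have Q0 : Q.[0] = 1 by rewrite QE big1 // => i _; rewrite mulr0 subr0.
have hm m : (0 < m)%N -> (m%:R^-1 = 0 :> R) \/
    exists2 k, (0 < k)%N & m%:R^-1 = k%:R^-1 :> R by right; exists m.
have Q01 m : (0 < m)%N -> 0 <= Q.[m%:R^-1] <= 1.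
  move=> /hm hu.
  (* An indicator is within 1/2 of the constant 1/2, so its average lies in [0, 1]. *)
  have : `|Q.[m%:R^-1] - (@map_sum R n (fun=> 2^-1)).[m%:R^-1]| <= 2^-1.
    apply: map_sum_le => // y; case: injectiveb; rewrite ?mulr1n ?mulr0n ler_norml; lra.
  rewrite map_sum_const hornerC ler_norml; lra.
have Qvanish m : (0 < m)%N -> (m < n)%N -> Q.[m%:R^-1] = 0.
  move=> m0 mn; rewrite QE (bigD1 (Ordinal mn)) //= divff ?subrr ?mul0r //.
  by rewrite pnatr_eq0 -lt0n.
have P0 : `|P.[0] - 1| <= 3^-1 by have := PQ 0 (or_introl erefl); rewrite Q0.
(* A constant [P] would be within 1/3 of both Q(0) = 1 and Q(1) = 0. *)
have d_gt0 : (0 < d)%N.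
  rewrite lt0n; apply/eqP => d0; move: szP; rewrite d0 => /size1_polyC PC.
  have := PQ _ (hm 1%N isT); rewrite (Qvanish 1%N) // subr0.
  by move: P0; rewrite PC !hornerC !ler_norml; lra.
split=> //; have d3 : (0 < d ^ 3)%N by rewrite expn_gt0 d_gt0.
(* This choice makes n(n - 1) / (2m) at least 3, so [prod_subr_le] gives Q(1/m) <= 1/4. *)
pose m := ((n * n.-1) %/ 6)%N.
have nn : (n ^ 2 <= 2 * (n * n.-1))%N by rewrite -mulnn; nia.
have mn : (n * n.-1 < m.+1 * 6)%N by apply: ltn_ceil.
have nm : (m * 6 <= n * n.-1)%N by apply: leq_divM.
suff : (m <= 192 * d ^ 3)%N by move: (d ^ 3)%N d3 nn mn => D; lia.
have [m0|m_gt0] := posnP m; first by rewrite m0.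
have mP : 0 < m%:R :> R by rewrite ltr0n.
have [hd|hd] := leqP (2 * d ^ 3)%N m; last by lia.
have Qm : Q.[m%:R^-1] <= 1 / 4.
  have [/(Qvanish _ m_gt0) -> | nlem] := ltnP m n; first by lra.
  have := @prod_subr_le R m%:R^-1 n; rewrite -QE.
  have u0 : 0 <= m%:R^-1 :> R by rewrite invr_ge0.
  move=> /(_ u0) hprod.
  have : 3 <= (n * n.-1)%:R / 2 / m%:R :> R.
    rewrite ler_pdivlMr // ler_pdivlMr // mulrAC -!natrM ler_nat; lia.
  have : Q.[m%:R^-1] * (1 + (n * n.-1)%:R / 2 * m%:R^-1) <= 1.
    apply: hprod => i ilt; rewrite ler_pdivrMr // mul1r ler_nat; lia.
  by have /andP[] := Q01 m m_gt0; nra.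
have := @reciprocal_bound R P d m 2 d_gt0 szP _ hd.
have hB k : (0 < k)%N -> `|P.[k%:R^-1] - P.[0]| <= 2.
  move=> k0; have := PQ _ (hm k k0); have := Q01 k k0; move: P0.
  by rewrite !ler_norml; lra.
move=> /(_ hB); rewrite ler_pdivlMr // => hmul.
have : (m%:R : R) <= 192 * d%:R ^+ 3.
  (* The drop is at least 3/4 - 2/3 = 1/12; with B = 2, [reciprocal_bound] yields 192 = 12 * 16. *)
  have : 1 / 12 <= `|P.[m%:R^-1] - P.[0]|.
    have := PQ _ (hm m m_gt0); have := P0; rewrite !ler_norml => /andP[P0l _] /andP[_ Pm].
    by rewrite distrC; apply: le_trans (ler_norm _); lra.
  by nra.
by rewrite -natrX -natrM ler_nat.
Qed.

(** * Error reduction by disjoint copies *)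

Section Blocks.
Variables (n m L : nat) (emb : 'I_L * 'I_m -> 'I_n).
Hypothesis emb_inj : injective emb.
Implicit Types (y : {ffun 'I_L -> {ffun 'I_m -> 'I_m}}).

(** Each block of points keeps its values inside the block. The identity elsewhere makes the glued
    map injective exactly when all pieces are. *)
Definition glue y : {ffun 'I_n -> 'I_n} :=
  [ffun k => if [pick bi | emb bi == k] is Some bi
             then emb (bi.1, y bi.1 bi.2) else k].

Lemma glue_emb y b i : glue y (emb (b, i)) = emb (b, y b i).
Proof.
rewrite ffunE; case: pickP => [bi /eqP /emb_inj -> //|/(_ (b, i))].
by rewrite eqxx.
Qed.

Lemma glue_out y k : k \notin codom emb -> glue y k = k.
Proof.
move=> kout; rewrite ffunE; case: pickP => // bi /eqP kE.
by rewrite -kE codom_f in kout.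
Qed.

Lemma injectiveb_glue y :
  injectiveb (glue y) = [forall b, injectiveb (y b)].
Proof.
apply/injectiveP/forallP => [h b|h].
  apply/injectiveP => i j yij; suff [] : (b, i) = (b, j) by [].
  by apply/emb_inj/h; rewrite !glue_emb yij.
have out_emb k bi : k \notin codom emb -> glue y k <> glue y (emb bi).
  case: bi => b i kout; rewrite glue_out // glue_emb => kE.
  by rewrite kE codom_f in kout.
move=> k l; have [/codomP[[b i] ->]|kout] := boolP (k \in codom emb);
  have [/codomP[[b' i'] ->]|lout] := boolP (l \in codom emb).
- rewrite !glue_emb => /emb_inj [bb]; subst b' => yii.
  by rewrite (injectiveP _ (h b) _ _ yii).
- by move=> /esym /out_emb; case.
- by move=> /out_emb; case.
by rewrite !glue_out.
Qed.

Definition restrict (S : {set 'I_n * 'I_n}) (b : 'I_L) : {set 'I_m * 'I_m} :=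
  [set e | (emb (b, e.1), emb (b, e.2)) \in S].

(** Different blocks pull back disjoint parts of [S]. *)
Lemma sum_card_restrict (S : {set 'I_n * 'I_n}) :
  (\sum_b #|restrict S b| <= #|S|)%N.
Proof.
pose U := [set u : 'I_L * ('I_m * 'I_m) | u.2 \in restrict S u.1].
have -> : (\sum_b #|restrict S b| = #|U|)%N.
  rewrite -sum1_card (eq_bigr (fun b => \sum_(e in restrict S b) 1)%N).
    rewrite pair_big_dep /=; apply: eq_bigl => -[b e].
    by rewrite !inE.
  by move=> b _; rewrite sum1_card.
pose F (u : 'I_L * ('I_m * 'I_m)) := (emb (u.1, u.2.1), emb (u.1, u.2.2)).
have F_inj : injective F.
  by move=> [b [i j]] [b' [i' j']] [] /emb_inj [-> ->] /emb_inj [->].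
rewrite -(card_imset _ F_inj); apply/subset_leq_card/subsetP => _ /imsetP[u uU ->].
by move: uU; rewrite !inE.
Qed.

(* The first disjunct occurs when [S] asks for a value outside the block. *)
Lemma extends_glue (S : {set 'I_n * 'I_n}) :
  (forall y, extends S (glue y) = false) \/
  (forall y, extends S (glue y) = [forall b, extends (restrict S b) (y b)]).
Proof.
(* A good pair is one that some glued map satisfies: it stays within one block, or it is a fixed
   point outside all blocks. *)
pose good (e : 'I_n * 'I_n) :=
  [exists b, [exists i, [exists j, e == (emb (b, i), emb (b, j))]]]
  || (e.1 \notin codom emb) && (e.1 == e.2).
have [/forall_inP Sgood|] := boolP [forall e in S, good e].
  right=> y; apply/forall_inP/forallP => [h b | h e eS].
    apply/forall_inP => e; rewrite inE => /h /=.
    by rewrite glue_emb (inj_eq emb_inj) => /eqP[/eqP].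
  have /orP[/existsP[b /existsP[i /existsP[j /eqP eE]]]|/andP[eout /eqP <-]] := Sgood e eS.
    rewrite eE /= glue_emb; apply/eqP; congr (emb (_, _)); apply/eqP.
    by apply: (forall_inP (h b) (i, j)); rewrite inE -eE.
  by rewrite glue_out.
rewrite negb_forall_in => /exists_inP[e eS ebad]; left=> y.
apply: contraNF ebad => /forall_inP /(_ e eS) /eqP ye.
have [/codomP[[b i] eE]|eout] := boolP (e.1 \in codom emb).
  apply/orP; left; apply/existsP; exists b; apply/existsP; exists i.
  apply/existsP; exists (y b i); rewrite -eE -glue_emb -eE ye.
  by case: (e).
by apply/orP; right; rewrite eout -ye glue_out //= eqxx.
Qed.

End Blocks.

(* The [L]-fold tensor power of a dual witness is orthogonal to every monomial
   whose restriction to some block has small degree. *)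
Lemma amplification (R : realFieldType) (n m L D : nat) (eps : R)
    (c : {set 'I_n * 'I_n} -> R) :
    (0 < L)%N -> (L * m <= n)%N -> eps <= 3 ^- L ->
    (forall y : {ffun 'I_n -> 'I_n},
       `|\sum_(S : {set 'I_n * 'I_n} | (#|S| <= D)%N) c S * (extends S y)%:R
         - (injectiveb y)%:R| <= eps) ->
  exists c' : {set 'I_m * 'I_m} -> R, forall y : {ffun 'I_m -> 'I_m},
    `|\sum_(S : {set 'I_m * 'I_m} | (#|S| <= D %/ L)%N) c' S * (extends S y)%:R
      - (injectiveb y)%:R| <= 3^-1.
Proof.
move=> L0 Lmn epsL happ.
have emb_lt (u : 'I_L * 'I_m) : (u.1 * m + u.2 < n)%N.
  case: u => b i /=; apply: leq_trans Lmn.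
  apply: (@leq_trans (b.+1 * m)); first by rewrite mulSnr ltn_add2l.
  by rewrite leq_mul2r ltn_ord orbT.
pose emb u := Ordinal (emb_lt u).
have emb_inj : injective emb.
  move=> [b i] [b' i'] /(congr1 val) /= h.
  have m0 : (0 < m)%N by apply: leq_trans (ltn_ord i).
  have bb : b = b' :> nat.
    by have := congr1 (divn^~ m) h; rewrite !divnMDl // !divn_small ?addn0.
  by congr (_, _); apply: val_inj => //=; move: h; rewrite bb => /addnI.
have [//|[psi [psi_orth psi_corr]]] := @approximation_duality R
  {ffun 'I_m -> 'I_m} {set 'I_m * 'I_m} (fun S => #|S| <= D %/ L)%N
  (fun S y => (extends S y)%:R) (fun y => (injectiveb y)%:R) 3^-1 ltac:(lra).
set norm := \sum_x `|psi x| in psi_corr.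
set corr := \sum_x psi x * _ in psi_corr.
pose Psi (y : {ffun 'I_L -> {ffun 'I_m -> 'I_m}}) := \prod_b psi (y b).
have tensor (F : {ffun 'I_m -> 'I_m} -> 'I_L -> R) :
  \sum_(y : {ffun 'I_L -> {ffun 'I_m -> 'I_m}}) \prod_b F (y b) b
    = \prod_b \sum_z F z b by rewrite bigA_distr_bigA.
have forallE (p : 'I_L -> bool) : [forall b, p b]%:R = \prod_b (p b)%:R :> R.
  have [/forallP h|] := boolP [forall b, p b].
    by rewrite big1 // => b _; rewrite h.
  by rewrite negb_forall => /existsP[b /negPf pb]; rewrite (bigD1 b) //= pb mul0r.
have Psi_orth (S : {set 'I_n * 'I_n}) : (#|S| <= D)%N ->
    \sum_y Psi y * (extends S (glue emb y))%:R = 0.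
  move=> SD; have [h|h] := extends_glue emb_inj S.
    by apply: big1 => y _; rewrite h mulr0.
  (* Pigeonhole: otherwise the restrictions would total at least L (D/L + 1) > D pairs. *)
  have [b bsmall] : exists b, (#|restrict emb S b| <= D %/ L)%N.
    apply/existsP; apply: contraT; rewrite negb_exists => /forallP hb.
    have : (\sum_(b < L) (D %/ L).+1 <= \sum_b #|restrict emb S b|)%N.
      by apply: leq_sum => b _; rewrite ltnNge hb.
    rewrite sum_nat_const card_ord => h1.
    have := leq_trans h1 (leq_trans (sum_card_restrict emb_inj S) SD).
    by rewrite leqNgt mulnC ltn_ceil.
  rewrite (eq_bigr (fun y : {ffun 'I_L -> {ffun 'I_m -> 'I_m}} =>
    \prod_b (psi (y b) * (extends (restrict emb S b) (y b))%:R))) => [|y _].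
    rewrite (tensor (fun z b => psi z * (extends (restrict emb S b) z)%:R)).
    by rewrite (bigD1 b) //= psi_orth ?mul0r.
  by rewrite h forallE big_split.
have corrE : \sum_y Psi y * (injectiveb (glue emb y))%:R = corr ^+ L.
  rewrite (eq_bigr (fun y : {ffun 'I_L -> {ffun 'I_m -> 'I_m}} =>
    \prod_b (psi (y b) * (injectiveb (y b))%:R))) => [|y _].
    rewrite (tensor (fun z b => psi z * (injectiveb z)%:R)).
    by rewrite prodr_const card_ord.
  by rewrite injectiveb_glue // forallE big_split.
have normE : \sum_y `|Psi y| = norm ^+ L.
  under eq_bigr do rewrite normr_prod.
  by rewrite (tensor (fun z _ => `|psi z|)) prodr_const card_ord.
have norm0 : 0 <= norm by apply: sumr_ge0.
(* [Psi] annihilates the approximant, so it correlates with injectivity only through the error. This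
   contradicts corr > norm / 3 once eps <= 3^-L. *)
have : corr ^+ L <= eps * norm ^+ L.
  rewrite -corrE -normE mulr_sumr.
  pose h (y : {ffun 'I_n -> 'I_n}) :=
    \sum_(S : {set 'I_n * 'I_n} | (#|S| <= D)%N) c S * (extends S y)%:R.
  have h0 : \sum_y Psi y * h (glue emb y) = 0.
    rewrite /h; under eq_bigr do rewrite mulr_sumr.
    rewrite exchange_big big1 // => S SD.
    under eq_bigr do rewrite mulrCA.
    by rewrite -mulr_sumr Psi_orth // mulr0.
  rewrite -[X in X <= _]subr0 -[X in _ - X <= _]h0 -sumrB; apply: ler_sum => y _.
  rewrite -mulrBr; apply: le_trans (ler_norm _) _.
  by rewrite normrM mulrC ler_wpM2r // distrC happ.
rewrite leNgt => /negP[]; apply: le_lt_trans (ler_wpM2r (exprn_ge0 _ norm0) epsL) _.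
by rewrite -exprVn -exprMn ltrXn2r // ?gtn_eqF // mulr_ge0 // invr_ge0.
Qed.

(** * The approximate degree of element distinctness *)

(** On 0/1 points a monomial depends only on its support, whose size is at most its degree, so
    coefficients with equal support are merged. *)
Lemma approximates_ED_extends (R : realType) (n : nat) (eps : R)
    (p : {mpoly R[n * n]}) :
    approximates (@Dpt R n n) eps (fun x => (ED x)%:R) p ->
  exists c : {set 'I_n * 'I_n} -> R, forall y : {ffun 'I_n -> 'I_n},
    `|\sum_(S : {set 'I_n * 'I_n} | (#|S| <= mdegree p)%N)
        c S * (extends S y)%:R - (injectiveb y)%:R| <= eps.
Proof.
move=> happ.
pose supp (mm : 'X_{1..n * n}) : {set 'I_n * 'I_n} :=
  [set e | (0 < mm (mxvec_index e.1 e.2))%N].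
exists (fun S => \sum_(mm <- msupp p | supp mm == S) p@_mm) => y.
pose M : 'M[bool]_n := \matrix_(i, j) (y i == j).
have Mrow : one_per_row M.
  apply/forallP => i; apply/cards1P; exists (y i).
  by apply/setP => j; rewrite !inE mxE eq_sym.
have EDE : ED (Sub M Mrow : Dmx n n) = injectiveb y.
  apply/forallP/injectiveP => [h i j yij | y_inj j].
    by apply: (card_le1_eqP (h (y i))); rewrite inE SubK mxE ?yij eqxx.
  apply/card_le1_eqP => i i'; rewrite !inE SubK !mxE => /eqP yi /eqP yi'.
  by apply: y_inj; rewrite yi.
have := happ (Sub M Mrow); rewrite EDE; congr (`|_ - _| <= _).
have monoE (mm : 'X_{1..n * n}) : \prod_k (Dpt R (Sub M Mrow : Dmx n n)) ord0 k ^+ mm k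
    = (extends (supp mm) y)%:R.
  rewrite (reindex _ (curry_mxvec_bij _ _)) /=.
  have [/forall_inP h | ] := boolP (extends (supp mm) y).
    apply: big1 => -[i j] _ /=; rewrite mxvecE !mxE.
    have := h (i, j); rewrite inE /= lt0n.
    by case: eqP => [-> | _ /(_ isT) ->]; rewrite ?expr0 ?expr1n.
  rewrite negb_forall_in => /exists_inP[[i j]]; rewrite inE /= => mmij /negPf yij.
  by rewrite (bigD1 (i, j)) //= mxvecE !mxE yij expr0n -[_ == 0%N]negbK -lt0n mmij mul0r.
have supp_le (mm : 'X_{1..n * n}) : mm \in msupp p -> (#|supp mm| <= mdegree p)%N.
  move=> /msize_mdeg_lt mmp; apply: (@leq_trans (mdeg mm)); last first.
    by rewrite /mdegree; case: (msize p) mmp.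
  rewrite mdegE (reindex _ (curry_mxvec_bij _ _)) /=.
  rewrite -sum1_card big_mkcond /=; apply: leq_sum => -[i j] _ /=.
  by rewrite inE /=; case: (mm _).
rewrite mevalE; under [RHS]eq_bigr do rewrite mulr_suml.
rewrite [RHS](exchange_big_dep predT) //= [RHS]big_seq_cond [LHS]big_seq_cond.
apply: eq_bigr => mm /andP[mmp _]; rewrite monoE.
rewrite (big_pred1 (supp mm)) // => S /=.
by case: (eqVneq (supp mm) S) => [<-|]; rewrite ?andbF // supp_le.
Qed.

Lemma ED_degree_cube (R : realType) (n L : nat) (eps : R)
    (p : {mpoly R[n * n]}) :
    (0 < L)%N -> (2 * L <= n)%N -> eps <= 3 ^- L ->
    approximates (@Dpt R n n) eps (fun x => (ED x)%:R) p ->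
  (n ^ 2 * L <= 10 ^ 4 * mdegree p ^ 3)%N.
Proof.
move=> L0 Ln epsL /approximates_ED_extends[c hc].
have hm : (L * (n %/ L) <= n)%N by rewrite mulnC leq_divM.
have [c' hc'] := amplification L0 hm epsL hc.
have m2 : (2 <= n %/ L)%N by rewrite leq_divRL.
have [_] := degree_lower_bound m2 hc'.
set m := (n %/ L)%N; set d := (mdegree p %/ L)%N => md.
(* Rounding n / L down loses at most a factor 2, since m >= 1. Squared, it turns 2500 into 10^4. *)
have nm : (n <= 2 * (L * m))%N.
  have : (n < m.+1 * L)%N by apply: ltn_ceil.
  have : (L * 1 <= L * m)%N by rewrite leq_mul2l ltnW ?orbT.
  by rewrite mulSn mulnC; lia.
have dD : (L * d <= mdegree p)%N by rewrite mulnC leq_divM.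
apply: (@leq_trans ((2 * (L * m)) ^ 2 * L)).
  by rewrite leq_mul2r leq_exp2r // nm orbT.
apply: (@leq_trans (10 ^ 4 * (L * d) ^ 3)); last first.
  by rewrite leq_mul2l leq_exp2r.
rewrite (_ : _ * L = 4 * L ^ 3 * m ^ 2)%N; last by ring.
rewrite (_ : 10 ^ 4 * _ = 4 * L ^ 3 * (2500 * d ^ 3))%N; last by ring.
by rewrite leq_mul2l md orbT.
Qed.

(** Take the largest admissible [L]. Either eps <= 3^-(L+1) fails, or n <= 2L + 1 <= 3L; as ln 3 <=
    2, both give the logarithmic bound. *)
Lemma block_count (R : realType) (n : nat) (eps : R) :
    (2 <= n)%N -> 3 ^- n <= eps -> eps <= 3^-1 ->
  exists L, [/\ (0 < L)%N, (2 * L <= n)%N, eps <= 3 ^- L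
    & ln (1 / eps) <= 6 * L%:R].
Proof.
move=> n2 eps_lo eps_hi.
have eps0 : 0 < eps by apply: lt_le_trans eps_lo; rewrite invr_gt0 exprn_gt0.
have ln3 : ln 3 <= 2 :> R.
  by rewrite (_ : 3 = 1 + 2) ?le_ln1Dx //; lra.
have ln30 : 0 <= ln 3 :> R by rewrite ln_ge0 //; lra.
have hln k : 3 ^- k <= eps -> ln (1 / eps) <= k%:R * ln 3.
  move=> h; rewrite mulr_natl -lnXn // ler_ln ?posrE ?divr_gt0 ?exprn_gt0 //.
  by rewrite div1r -[X in _ <= X]invrK lef_pV2 ?posrE ?invr_gt0 ?exprn_gt0.
pose good L := (0 < L)%N && ((2 * L <= n)%N && (eps <= 3 ^- L)).
have good1 : exists L, good L by exists 1%N; rewrite /good /= muln1 n2 expr1.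
have bound L : good L -> (L <= n)%N by move=> /and3P[_ h _]; lia.
have [L /and3P[L0 Ln epsL] Lmax] := ex_maxnP good1 bound.
exists L; split=> //.
have LR : 1 <= L%:R :> R by rewrite ler1n.
have [h|h] := leqP (2 * L.+1) n.
  have : 3 ^- L.+1 <= eps.
    rewrite leNgt; apply/negP => /ltW h'.
    by have := Lmax L.+1; rewrite ltnn /good h h' => /(_ isT).
  move=> /hln; rewrite -[L.+1]addn1 natrD; nra.
have : (n%:R : R) <= 3 * L%:R by rewrite -natrM ler_nat; lia.
by have := hln n eps_lo; nra.
Qed.

Theorem theorem3p3 (R : realType) :
  exists c : R, 0 < c /\
    forall (n : nat) (eps : R), (2 <= n)%N -> 3 ^- n <= eps -> eps <= 3^-1 ->
      c * n%:R `^ (2 / 3) * (ln (1 / eps)) `^ (1 / 3)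
        <= (approx_degree_ED n eps)%:R.
Proof.
(* The cubed inequality needs 6 * 10^4 <= 40^3, with 6 from [block_count] and 10^4 from
   [ED_degree_cube]. *)
exists (40^-1); split; first by rewrite invr_gt0.
move=> n eps n2 eps_lo eps_hi.
have eps0 : 0 < eps by apply: lt_le_trans eps_lo; rewrite invr_gt0 exprn_gt0.
have [L [L0 Ln epsL lnL]] := block_count n2 eps_lo eps_hi.
rewrite /approx_degree_ED.
have [[p happ <-] _] :=
  approx_degreeP (fun x : Dmx n n => (ED x)%:R) (@Dpt_inj R n n) (ltW eps0).
have := ED_degree_cube L0 Ln epsL happ.
rewrite -(ler_nat R) natrM natrX natrM !natrX => hcube.
have ln0 : 0 <= ln (1 / eps).
  rewrite ln_ge0 // ler_pdivlMr // mul1r; lra.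
have cube (a b : R) : 0 <= a -> (a `^ (b / 3)) ^+ 3 = a `^ b.
  by move=> a0; rewrite -powR_mulrn ?powR_ge0 // -powRrM divfK ?pnatr_eq0.
rewrite -(@ler_pXn2r _ 3) ?nnegrE ?mulr_ge0 ?powR_ge0 ?invr_ge0 //.
rewrite !exprMn !cube ?ler0n // powR_mulrn // powRr1 //.
have : n%:R ^+ 2 * ln (1 / eps) <= n%:R ^+ 2 * (6 * L%:R).
  by rewrite ler_wpM2l ?exprn_ge0.
rewrite exprVn -mulrA ler_pdivrMl ?exprn_gt0 //.
have : 0 <= (mdegree p)%:R ^+ 3 :> R by rewrite exprn_ge0.
lra.
Qed.
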